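(* Let $d\ge2$ and let $\mathcal{H}\subset\mathbf{P}^{2^d-1}$ be the image of the Segre embedding of the product $\mathbf{P}^1\times\cdots\times\mathbf{P}^1$ of $d$ copies of the projective line over $\mathbf{F}_q$. Let $s$ be an integer with $0\le s<q$. Then the evaluation code $C_{\mathcal{H}}(s)$ has parameters $[(q+1)^d,(s+1)^d,(q-s+1)^d]$, and it is (up to permutation of coordinates) the $d$-fold tensor product $C_{\mathbf{P}^1}(s)\otimes\cdots\otimes C_{\mathbf{P}^1}(s)$ of the extended Reed--Solomon code $C_{\mathbf{P}^1}(s)$.
   Context: The Segre embedding sends $((u_1:v_1),\dots,(u_d:v_d))$ to the point of $\mathbf{P}^{2^d-1}$ whose coordinates, indexed by subsets $S\subseteq\{1,\dots,d\}$, are $\prod_{j\in S}u_j\prod_{j\notin S}v_j$. For a smooth projective variety $X\subset\mathbf{P}^r$ over $\mathbf{F}_q$ and $s\ge0$, $C_X(s)\subseteq\mathbf{F}_q^n$ is the image of the map sending a homogeneous polynomial $f\in\mathbf{F}_q[x_0,\dots,x_r]$ of degree $s$ to $(f(P_1),\dots,f(P_n))$, where $P_1,\dots,P_n$ are the $\mathbf{F}_q$-rational points of $X$ and $f(P)$ is evaluated at the representative of $P$ whose first nonzero coordinate from the left is $1$. $C_{\mathbf{P}^1}(s)$ (evaluation of binary forms of degree $s$ at $\mathbf{P}^1(\mathbf{F}_q)$) is the extended Reed--Solomon code with parameters $[q+1,s+1,q-s+1]$. Parameters $[n,k,d]$ denote length, dimension, minimum Hamming distance. *)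

(* Defs.v *)
From HB Require Import structures.
From mathcomp Require Import all_boot all_order all_algebra all_field.
Set Implicit Arguments. Unset Strict Implicit. Unset Printing Implicit Defensive.
Import GRing.Theory.
Local Open Scope ring_scope.

Section Defs.
Variable F : finFieldType.

Definition monom (V : finType) (s : nat) := {ffun V -> 'I_s.+1}.
(* A homogeneous polynomial of degree s in the variables x_v (v : V), given by
   its coefficients; only monomials of total degree s are used. *)
Definition hform (V : finType) (s : nat) := {ffun monom V s -> F}.

Definition eval_form (V : finType) (s : nat) (f : hform V s) (x : {ffun V -> F}) : F :=
  \sum_(m : monom V s | (\sum_(v : V) (m v : nat))%N == s)
      f m * \prod_(v : V) x v ^+ (m v : nat).

(* Evaluation code C_X(s): image of f |-> (f(P))_P, P ranging over the
   (normalized representatives of the) rational points of X. Words are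
   functions on the finite point set (the coordinates). *)
Definition eval_code (V : finType) (Pt : finType) (coords : Pt -> {ffun V -> F})
  (s : nat) : {set {ffun Pt -> F}} :=
  [set [ffun P => eval_form f (coords P)] | f : hform V s].

Definition hwt (Pt : finType) (w : {ffun Pt -> F}) : nat := #|[set P | w P != 0]|.

(* dimension of a code = dimension of the F-subspace it spans
   (the codes considered are subspaces, so this is their dimension) *)
Definition code_dim (Pt : finType) (C : {set {ffun Pt -> F}}) : nat :=
  \dim <<(enum C : seq {ffun Pt -> F^o})>>%VS.

(* minimum Hamming distance of a linear code = min weight of a nonzero word *)
Definition min_dist (Pt : finType) (C : {set {ffun Pt -> F}}) (k : nat) : Prop :=
  (exists2 c, c \in C & (c != 0) && (hwt c == k)) /\
  (forall c, c \in C -> c != 0 -> (k <= hwt c)%N).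

Definition P1_norm (x : F * F) : bool :=
  (x.1 == 1) || ((x.1 == 0) && (x.2 == 1)).
Definition P1pt := {x : F * F | P1_norm x}.
Definition P1_coords (P : P1pt) : {ffun 'I_2 -> F} :=
  [ffun i : 'I_2 => if (i : nat) == 0%N then (val P).1 else (val P).2].

Definition RS_code (s : nat) : {set {ffun P1pt -> F}} := eval_code P1_coords s.

Definition segre (d : nat) (u : {ffun 'I_d -> F * F}) : {ffun {set 'I_d} -> F} :=
  [ffun S : {set 'I_d} =>
     (\prod_(j in S) (u j).1) * \prod_(j in ~: S) (u j).2].

(* Order of coordinates: lexicographic in the "u before v" order, i.e.
   S comes before T iff seg_key S > seg_key T. *)
Definition seg_key (d : nat) (S : {set 'I_d}) : nat :=
  (\sum_(j in S) 2 ^ (d.-1 - j))%N.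

Definition H_norm (d : nat) (x : {ffun {set 'I_d} -> F}) : bool :=
  [exists S, (x S == 1) && [forall T, (seg_key S < seg_key T)%N ==> (x T == 0)]].

Definition on_segre (d : nat) (x : {ffun {set 'I_d} -> F}) : bool :=
  [exists u : {ffun 'I_d -> F * F},
     [forall j, u j != (0, 0)] && [exists l : F, x == [ffun S => l * segre u S]]].

Definition Hpt (d : nat) := {x : {ffun {set 'I_d} -> F} | H_norm x && on_segre x}.

Definition H_code (d s : nat) : {set {ffun Hpt d -> F}} :=
  eval_code (fun P : Hpt d => val P) s.

Definition tensor_gens (d : nat) (C : {set {ffun P1pt -> F}})
  : {set {ffun {ffun 'I_d -> P1pt} -> F}} :=
  [set [ffun x : {ffun 'I_d -> P1pt} => \prod_(j < d) c j (x j)]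
     | c : {ffun 'I_d -> {ffun P1pt -> F}} & [forall j, c j \in C]].

Definition tensor_code (d : nat) (C : {set {ffun P1pt -> F}})
  : {vspace {ffun {ffun 'I_d -> P1pt} -> F^o}} :=
  <<(enum (tensor_gens d C) : seq {ffun {ffun 'I_d -> P1pt} -> F^o})>>%VS.

End Defs.

(* Main.v *)
Require Import Defs.
From HB Require Import structures.
From mathcomp Require Import all_boot all_order all_algebra all_field.
From mathcomp Require Import zify.

(** A point of the Segre image is uniquely the image of a tuple of normalized
    points [(u_j : v_j)] of the line, and that image is again normalized, its
    first nonzero coordinate being the one indexed by [{j | u_j = 1}].  Under this
    bijection a monomial of degree [s] restricts to a product of binary monomials
    [u_j ^ (s - a_j) * v_j ^ a_j], and all exponents [0 <= a_j <= s] occur; such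
    products also span the tensor power.  They are independent because the factors
    have a dual family, which comes from the fact that a nonzero binary form of
    degree [s < q] has a nonzero value.  Every line restriction of a word lies in
    the Reed-Solomon code, so the minimum weights multiply, and products of
    minimum-weight words attain the bound. *)

Set Implicit Arguments. Unset Strict Implicit. Unset Printing Implicit Defensive.
Import GRing.Theory.
Local Open Scope ring_scope.

(** * Codes spanned by a finite family of functions, and weights over product sets *)

Lemma mem_span_codom (F : fieldType) (Pt A : finType) (M : A -> {ffun Pt -> F^o})
    (w : {ffun Pt -> F^o}) :
  reflect (exists c : A -> F, forall P, w P = \sum_a c a * M a P)
          (w \in <<codom M>>%VS).
Proof.
have eq_comb c : (forall P, w P = \sum_a c a * M a P) <->
    w = \sum_a c a *: M a.
  split=> [Dw | -> P]; last by rewrite sum_ffunE; apply: eq_bigr => a _; rewrite ffunE.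
  by apply/ffunP=> P; rewrite Dw sum_ffunE; apply: eq_bigr => a _; rewrite ffunE.
apply: (iffP idP) => [|[c /eq_comb->]]; last first.
  by apply: rpred_sum => a _; rewrite rpredZ ?memv_span ?codom_f.
rewrite span_def big_image /= => /memv_sumP[v Mv Dw].
have /fin_all_exists[c Dc] a : exists k, v a = k *: M a by apply/vlineP/Mv.
by exists c; apply/eq_comb; rewrite Dw; apply: eq_bigr => a _; rewrite Dc.
Qed.

Lemma free_codom (F : fieldType) (Pt A : finType) (M : A -> {ffun Pt -> F^o}) :
    (forall c : A -> F, (forall P, \sum_a c a * M a P = 0) -> forall a, c a = 0) ->
  free (codom M).
Proof.
move=> M_free; have -> : codom M = codom_tuple M by [].
apply/freeP=> k Ek i.
rewrite -[i]enum_valK; apply: (M_free (fun a => k (enum_rank a))) => P.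
have /ffunP/(_ P) := Ek; rewrite ffunE sum_ffunE => {2}<-.
rewrite (reindex (@enum_val A predT)) /=; last first.
  by exists enum_rank => j _; rewrite (enum_valK, enum_rankK).
apply: eq_bigr => j _; rewrite !ffunE enum_valK; congr (_ * _).
by rewrite (nth_map (enum_val j)) -?cardE ?ltn_ord // -enum_val_nth.
Qed.

Definition mdeg (V : finType) (s : nat) (m : monom V s) := (\sum_(v : V) m v)%N.

(** Distinct monomials may restrict to the same function on the points, so coefficients are summed
    over the fibres of [g]. Conversely, [mon] realizes every [M a] by a monomial of the right
    degree. *)
Lemma eval_codeP (F : finFieldType) (V Pt A : finType)
    (coords : Pt -> {ffun V -> F}) (s : nat) (M : A -> Pt -> F)
    (g : monom V s -> A) (mon : A -> monom V s) :
    (forall m P, mdeg m = s -> \prod_v coords P v ^+ m v = M (g m) P) ->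
    (forall a, mdeg (mon a) = s) ->
    (forall a P, \prod_v coords P v ^+ mon a v = M a P) ->
  forall w : {ffun Pt -> F},
  reflect (exists c : A -> F, forall P, w P = \sum_a c a * M a P)
          (w \in eval_code coords s).
Proof.
move=> Mg deg_mon Mmon w; apply: (iffP imsetP) => [[f _ ->] | [c Dw]].
  exists (fun a => \sum_(m | (mdeg m == s) && (g m == a)) f m) => P.
  rewrite ffunE /eval_form (partition_big g predT) //=; apply: eq_bigr => a _.
  rewrite mulr_suml; apply: eq_bigr => m /andP[/eqP deg_m /eqP <-].
  by rewrite Mg.
exists [ffun m => \sum_(a | mon a == m) c a] => //; apply/ffunP=> P.
rewrite Dw ffunE /eval_form (partition_big mon (fun m => mdeg m == s)) /=; last first.
  by move=> a _; rewrite deg_mon.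
apply: eq_bigr => m _; rewrite ffunE mulr_suml.
by apply: eq_bigr => a /eqP <-; rewrite Mmon.
Qed.

Lemma code_dim_basis (F : finFieldType) (Pt A : finType) (C : {set {ffun Pt -> F}})
    (M : A -> Pt -> F) :
    (forall w : {ffun Pt -> F},
       w \in C <-> exists c : A -> F, forall P, w P = \sum_a c a * M a P) ->
    (forall c : A -> F, (forall P, \sum_a c a * M a P = 0) -> forall a, c a = 0) ->
  code_dim C = #|A|.
Proof.
move=> CP M_free; pose M' a : {ffun Pt -> F^o} := [ffun P => M a P].
have Mfun c P : \sum_a c a * M' a P = \sum_a c a * M a P.
  by apply: eq_bigr => a _; rewrite ffunE.
have memC w : (w \in <<codom M'>>%VS) = (w \in C).
  apply/mem_span_codom/idP=> [[c Dw] | /CP[c Dw]]; last by exists c => P; rewrite Dw Mfun.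
  by apply/CP; exists c => P; rewrite Dw Mfun.
have -> : code_dim C = \dim <<codom M'>>%VS.
  (* [C] is already the whole span of the family, so enumerating its words as generators adds
     nothing. *)
  rewrite /code_dim; congr (\dim _); apply/eqP; rewrite eqEsubv.
  apply/andP; split; apply/span_subvP=> w; rewrite ?mem_enum -?memC //.
  by move/memv_span; rewrite memC => wC; apply: memv_span; rewrite mem_enum.
suffices /eqP-> : free (codom M') by rewrite size_codom.
by apply: free_codom => c c0; apply: M_free => P; rewrite -Mfun c0.
Qed.

(* Over a line through a nonzero point the word keeps at least [k] nonzero
   values, and the slices through these are disjoint: induct on the number of
   free coordinates. *)
Lemma product_hwt (R : nzRingType) (X : finType) (n k : nat)
    (w : {ffun 'I_n -> X} -> R) :
    (forall x j, w x != 0 ->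
       (k <= #|[set y | w [ffun i => if i == j then y else x i] != 0%R]|)%N) ->
  forall x, w x != 0 -> (k ^ n <= #|[set x | w x != 0%R]|)%N.
Proof.
move=> w_line.
pose slice m x := [set y : {ffun 'I_n -> X} |
   (w y != 0) && [forall i : 'I_n, (m <= i)%N ==> (y i == x i)]].
have{w_line} w_slice m : (m <= n)%N -> forall x, w x != 0 -> (k ^ m <= #|slice m x|)%N.
  elim: m => [|m IHm] lt_mn x wx.
    rewrite expn0 card_gt0; apply/set0Pn; exists x.
    by rewrite inE wx; apply/forallP=> i; rewrite eqxx.
  pose j := Ordinal lt_mn; pose upd y := [ffun i => if i == j then y else x i].
  pose L := [set y | w (upd y) != 0].
  have le_L : (\sum_(y in L) #|slice m (upd y)| <= #|slice m.+1 x|)%N.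
    (* Sorting the larger slice by its [j]-th coordinate makes the smaller slices its disjoint
       pieces. *)
    rewrite -[leqRHS]sum1_card (partition_big (fun z : {ffun 'I_n -> X} => z j) predT) //=.
    rewrite [leqRHS](bigID (mem L)) /= (leq_trans _ (leq_addr _ _)) //.
    apply: leq_sum => y _; rewrite -sum1_card; apply/eq_leq/eq_bigl => z.
    rewrite !inE -andbA; congr (_ && _).
    apply/forallP/andP=> [zu | [/forallP zx /eqP zy] i].
      split; last by have := zu j; rewrite leqnn ffunE eqxx.
      apply/forallP=> i; apply/implyP=> lt_mi.
      have := zu i; rewrite (ltnW lt_mi) ffunE.
      by case: (i =P j) lt_mi => [->|]; rewrite ?ltnn.
    rewrite ffunE; case: (i =P j) => [->|/eqP ne_ij]; first by rewrite zy eqxx implybT.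
    apply/implyP=> le_mi; apply: (implyP (zx i)).
    by rewrite ltn_neqAle eq_sym le_mi andbT.
  apply: leq_trans le_L; rewrite expnS.
  apply: (@leq_trans (#|L| * k ^ m)); first by rewrite leq_mul2r w_line ?orbT.
  rewrite -sum_nat_const; apply: leq_sum => y; rewrite inE => wy.
  exact: IHm (ltnW lt_mn) _ wy.
move=> x wx; apply: leq_trans (w_slice n (leqnn n) x wx) _.
by apply/subset_leq_card/subsetP=> y; rewrite !inE => /andP[].
Qed.

(** * Rational points of the projective line *)

Section ProjectiveLine.
Variable F : finFieldType.

Lemma P1_aff_norm (v : F) : P1_norm ((1, v) : F * F).
Proof. by rewrite /P1_norm eqxx. Qed.
Lemma P1_inf_norm : P1_norm ((0, 1) : F * F).
Proof. by rewrite /P1_norm !eqxx orbT. Qed.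
Definition P1_aff (v : F) : P1pt F := exist _ ((1, v) : F * F) (P1_aff_norm v).
Definition P1_inf : P1pt F := exist _ ((0, 1) : F * F) P1_inf_norm.

(** The affine line with one point added: [None] stands for the point (0 : 1) at infinity. *)
Definition P1_of_option (o : option F) : P1pt F := oapp P1_aff P1_inf o.

Lemma P1_of_option_bij : bijective P1_of_option.
Proof.
exists (fun P : P1pt F => if (sval P).1 == 1 then Some (sval P).2 else None).
  by case=> [v|] /=; rewrite ?eqxx // eq_sym oner_eq0.
case=> -[u v] nP; apply: val_inj; move: nP => /=.
rewrite /P1_norm /=; case: eqP => [-> // | _] /= /andP[/eqP-> /eqP->] //.
Qed.

Lemma big_P1 (f : P1pt F -> nat) :
  (\sum_P f P = f P1_inf + \sum_v f (P1_aff v))%N.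
Proof.
rewrite (reindex P1_of_option) /=; last exact/onW_bij/P1_of_option_bij.
rewrite (bigD1 None) //=; congr addn.
rewrite (reindex_omap Some id) /=; last by case.
by apply: eq_bigl => v; rewrite eqxx.
Qed.

Lemma card_P1 : #|{: P1pt F}| = #|F|.+1.
Proof.
by rewrite -card_option; apply/esym/(bij_eq_card P1_of_option_bij).
Qed.

Lemma card_P1_nz (f : P1pt F -> F) :
  #|[set P | f P != 0]| = ((f P1_inf != 0%R) + #|[set v | f (P1_aff v) != 0%R]|)%N.
Proof.
by rewrite !cardsE -!sum1_card !(big_mkcond (fun x => x \in _)) big_P1 unfold_in; case: (f _ == 0).
Qed.

End ProjectiveLine.

(** * Binary forms of degree [s] and the extended Reed-Solomon code *)

Section BinaryForms.
Variables (F : finFieldType) (s : nat).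

Definition bmon (b : 'I_s.+1) (x : F * F) : F := x.1 ^+ (s - b) * x.2 ^+ b.

Lemma bmon_aff (b : 'I_s.+1) (v : F) : bmon b ((1, v) : F * F) = v ^+ b.
Proof. by rewrite /bmon expr1n mul1r. Qed.

(** Only [b = s] survives at infinity, thanks to [0 ^+ 0 = 1]. *)
Lemma bmon_inf (b : 'I_s.+1) : bmon b ((0, 1) : F * F) = (b == ord_max)%:R.
Proof.
by rewrite /bmon expr1n mulr1 expr0n subn_eq0 -val_eqE /= eqn_leq -[(b <= s)%N]ltnS ltn_ord.
Qed.

(** Dehomogenization at [u = 1]; the value of the form at infinity is the coefficient of degree
    [s]. *)
Definition bpoly (c : 'I_s.+1 -> F) : {poly F} := \sum_b c b *: 'X^b.

Lemma size_bpoly c : (size (bpoly c) <= s.+1)%N.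
Proof.
apply: (leq_trans (size_sum _ _ _)); apply/bigmax_leqP=> b _.
by rewrite (leq_trans (size_scale_leq _ _)) // size_polyXn.
Qed.

Lemma coef_bpoly c (b : 'I_s.+1) : (bpoly c)`_b = c b.
Proof.
rewrite coef_sum (bigD1 b) //= coefZ coefXn eqxx mulr1 big1 ?addr0 // => i ne_ib.
by rewrite coefZ coefXn val_eqE eq_sym (negPf ne_ib) mulr0.
Qed.

Lemma bform_aff c v : \sum_b c b * bmon b ((1, v) : F * F) = (bpoly c).[v].
Proof.
by rewrite horner_sum; apply: eq_bigr => b _; rewrite bmon_aff hornerZ hornerXn.
Qed.

Lemma bform_inf c : \sum_b c b * bmon b ((0, 1) : F * F) = (bpoly c)`_s.
Proof.
rewrite (coef_bpoly c ord_max) (bigD1 ord_max) //= bmon_inf eqxx mulr1 big1 ?addr0 //.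
by move=> b /negPf ne_b; rewrite bmon_inf ne_b mulr0.
Qed.

Lemma card_roots_lt (p : {poly F}) : p != 0 -> (#|[set v | root p v]| < size p)%N.
Proof.
move=> nz_p; rewrite cardE; apply: max_poly_roots => //; last exact: enum_uniq.
by apply/allP=> v; rewrite mem_enum inE.
Qed.

Lemma bform_hwt (c : 'I_s.+1 -> F) (f : P1pt F -> F) :
    (s < #|F|)%N -> (forall P, f P = \sum_b c b * bmon b (val P)) -> forall P, f P != 0 ->
  (#|F| - s + 1 <= #|[set Q | f Q != 0%R]|)%N.
Proof.
move=> lt_sF Df P nz_fP; pose p := bpoly c.
have nz_p : p != 0.
  apply: contraNneq nz_fP => p0; rewrite Df big1 // => b _.
  by rewrite -coef_bpoly -/p p0 coef0 mul0r.
have aff v : f (P1_aff v) = p.[v] by rewrite Df bform_aff.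
rewrite card_P1_nz Df bform_inf -/p.
under eq_finset do rewrite aff -[_ == 0]/(root p _).
have <- : ~: [set v | root p v] = [set v | ~~ root p v].
  by apply/setP=> v; rewrite !inE.
have := cardsC [set v | root p v]; have := card_roots_lt nz_p; have := size_bpoly c.
rewrite -/p; set r := #|_|; set r' := #|_| => sz_p lt_r rr'.
have {rr'} card_rr' : #|F| = (r + r')%N by rewrite rr'.
rewrite card_rr' in lt_sF *; clearbody r r'.
(* If the top coefficient is nonzero, infinity contributes 1 and there are at most [s] affine roots.
   Otherwise infinity contributes nothing, but the degree drops and there are at most [s - 1]
   roots. *)
case: (eqVneq p`_s 0) => [ps0 | _] /=; last by lia.
have {}sz_p : (size p <= s)%N.
  apply/leq_sizeP=> j; rewrite leq_eqVlt => /predU1P[<- // | lt_sj].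
  by rewrite nth_default // (leq_trans sz_p).
by lia.
Qed.

(** The affine points suffice: a polynomial of degree at most [s] with [#|F| > s] roots is zero. *)
Lemma bform_free (c : 'I_s.+1 -> F) : (s < #|F|)%N ->
  (forall P : P1pt F, \sum_b c b * bmon b (val P) = 0) -> forall b, c b = 0.
Proof.
move=> lt_sF c0 b; rewrite -coef_bpoly.
suffices -> : bpoly c = 0 by rewrite coef0.
apply: (roots_geq_poly_eq0 (rs := enum F)); rewrite ?enum_uniq //.
  by apply/allP=> v _; rewrite /root -bform_aff (c0 (P1_aff v)).
by rewrite -cardE (leq_trans (size_bpoly c)).
Qed.

(** By [bform_free] the evaluation matrix has independent rows, hence a right inverse; its columns
    are the dual functionals. *)
Lemma bmon_dual : (s < #|F|)%N -> exists L : 'I_s.+1 -> P1pt F -> F,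
  forall b b', \sum_P L b P * bmon b' (val P) = (b' == b)%:R.
Proof.
move=> lt_sF.
pose A := \matrix_(b < s.+1, i < #|{: P1pt F}|) bmon b (val (enum_val i)).
have /row_freeP[B AB] : row_free A.
  apply: inj_row_free => v vA; apply/rowP=> b; rewrite mxE.
  apply: (bform_free (c := v 0)) => // P.
  have /rowP/(_ (enum_rank P)) := vA; rewrite !mxE => {2}<-.
  by apply: eq_bigr => b' _; rewrite mxE enum_rankK.
exists (fun b P => B (enum_rank P) b) => b b'.
have /matrixP/(_ b' b) := AB; rewrite !mxE => <-.
rewrite (reindex (@enum_val (P1pt F) predT)) /=; last first.
  by exists enum_rank => j _; rewrite (enum_valK, enum_rankK).
by apply: eq_bigr => i _; rewrite mxE enum_valK mulrC.
Qed.

Lemma bform_hwt_attained : (s < #|F|)%N -> exists c : 'I_s.+1 -> F,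
  #|[set P : P1pt F | \sum_b c b * bmon b (val P) != 0%R]| = (#|F| - s + 1)%N.
Proof.
(* The extremal form has [s] distinct affine roots. Its polynomial is monic of degree exactly [s],
   so it does not vanish at infinity. *)
move=> lt_sF; pose rs := take s (enum F).
have sz_rs : size rs = s by rewrite size_takel // -cardE ltnW.
have uniq_rs : uniq rs by rewrite take_uniq ?enum_uniq.
pose p := \prod_(a <- rs) ('X - a%:P).
have sz_p : size p = s.+1 by rewrite size_prod_XsubC sz_rs.
exists (fun b => p`_b); have Dp : bpoly (fun b => p`_b) = p.
  by rewrite /bpoly -sz_p -poly_def coefK.
rewrite card_P1_nz bform_inf Dp.
have -> : p`_s = 1.
  by have /monicP := monic_prod_XsubC rs predT id; rewrite lead_coefE -/p sz_p.
under eq_finset do rewrite bform_aff Dp -[_ == 0]/(root p _) root_prod_XsubC.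
rewrite oner_eq0 /= addnC; congr addn.
have <- : ~: [set v in rs] = [set v | v \notin rs].
  by apply/setP=> v; rewrite !inE.
by rewrite cardsCs setCK cardsE (card_uniqP uniq_rs) sz_rs.
Qed.

Lemma RS_codeP (w : {ffun P1pt F -> F}) :
  reflect (exists c : 'I_s.+1 -> F, forall P, w P = \sum_b c b * bmon b (val P))
          (w \in RS_code F s).
Proof.
(* The degree forces the exponent of the first variable, so the second exponent indexes the
   monomials. *)
pose mon (b : 'I_s.+1) : monom 'I_2 s :=
  [ffun i : 'I_2 => if i == ord0 then inord (s - b) else b].
have coordsE (m : monom 'I_2 s) P :
    \prod_v P1_coords P v ^+ m v = (val P).1 ^+ m ord0 * (val P).2 ^+ m ord_max.
  rewrite !big_ord_recl big_ord0 mulr1 !ffunE /=.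
  by congr (_ * _ ^+ m _); apply: val_inj.
have degE (m : monom 'I_2 s) : mdeg m = (m ord0 + m ord_max)%N.
  rewrite /mdeg !big_ord_recl big_ord0 addn0.
  by congr (_ + m _)%N; apply: val_inj.
apply: (eval_codeP (M := fun b P => bmon b (val P)) (g := fun m => m ord_max) (mon := mon)).
- by move=> m P; rewrite degE coordsE /bmon => /(canRL (addnK _)) <-.
- by move=> b; rewrite degE !ffunE /= inordK ?ltnS ?leq_subr // subnK // -ltnS.
- by move=> b P; rewrite coordsE !ffunE /= inordK // ltnS leq_subr.
Qed.

End BinaryForms.

(** * Products of binary forms and the tensor power of the Reed-Solomon code *)

Section ProductForms.
Variables (F : finFieldType) (d s : nat).
Hypothesis lt_sF : (s < #|F|)%N.

Definition pmon (a : {ffun 'I_d -> 'I_s.+1}) (x : {ffun 'I_d -> P1pt F}) : F :=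
  \prod_j bmon (a j) (val (x j)).

(** Products of the functionals from [bmon_dual] are dual to the [pmon a], since the sum over tuples
    factors into sums over single coordinates. Pairing with them isolates each coefficient. *)
Lemma pmon_free (c : {ffun 'I_d -> 'I_s.+1} -> F) :
  (forall x, \sum_a c a * pmon a x = 0) -> forall a, c a = 0.
Proof.
move=> c0 a; have [L Ldual] := bmon_dual lt_sF.
have dual a' : \sum_(x : {ffun 'I_d -> P1pt F}) (\prod_j L (a j) (x j)) * pmon a' x = (a' == a)%:R.
  under eq_bigr do rewrite -big_split /=.
  rewrite -(bigA_distr_bigA (fun j P => L (a j) P * bmon (a' j) (val P))) /=.
  under eq_bigr do rewrite Ldual.
  have [-> | /eqP ne] := eqVneq a' a; first by rewrite big1 // => j _; rewrite eqxx.
  have [j ne_j] : exists j, a' j != a j.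
    by apply/existsP; rewrite -negb_forall; apply/negP=> /forallP eq_a;
       apply: ne; apply/ffunP=> j; apply/eqP/eq_a.
  by rewrite (bigD1 j) //= (negPf ne_j) mul0r.
have : \sum_(x : {ffun 'I_d -> P1pt F}) (\prod_j L (a j) (x j)) * (\sum_a' c a' * pmon a' x) = 0.
  by rewrite big1 // => x _; rewrite c0 mulr0.
under eq_bigr do rewrite mulr_sumr.
rewrite exchange_big (bigD1 a) //=.
have inner a' : \sum_(x : {ffun 'I_d -> P1pt F}) (\prod_j L (a j) (x j)) * (c a' * pmon a' x) = c a' * (a' == a)%:R.
  by rewrite -dual mulr_sumr; apply: eq_bigr => x _; rewrite mulrCA.
rewrite inner eqxx mulr1 big1 ?addr0 // => a' /negPf ne_a.
by rewrite inner ne_a mulr0.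
Qed.

Lemma pform_prod (c : 'I_d -> 'I_s.+1 -> F) (x : {ffun 'I_d -> P1pt F}) :
  \prod_j (\sum_b c j b * bmon b (val (x j))) =
  \sum_(a : {ffun 'I_d -> 'I_s.+1}) (\prod_j c j (a j)) * pmon a x.
Proof.
rewrite (bigA_distr_bigA (fun j b => c j b * bmon b (val (x j)))) /=.
by apply: eq_bigr => a _; rewrite big_split.
Qed.

Lemma pform_hwt (c : {ffun 'I_d -> 'I_s.+1} -> F) (w : {ffun 'I_d -> P1pt F} -> F) :
    (forall x, w x = \sum_a c a * pmon a x) -> forall x, w x != 0 ->
  ((#|F| - s + 1) ^ d <= #|[set y | w y != 0%R]|)%N.
Proof.
move=> Dw; apply: product_hwt => x j nz_wx.
pose upd y := [ffun i => if i == j then y else x i].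
(* Coefficients of the binary form that [w] becomes when every coordinate of [x] but the [j]-th is
   frozen. *)
pose c' b := \sum_(a : {ffun 'I_d -> 'I_s.+1} | a j == b)
   c a * \prod_(i | i != j) bmon (a i) (val (x i)).
apply: (@bform_hwt _ _ c' (fun y => w (upd y)) lt_sF _ (x j)) => [y|]; last first.
  suffices -> : upd (x j) = x by [].
  by apply/ffunP=> i; rewrite ffunE; case: eqP => // ->.
rewrite Dw (partition_big (fun a : {ffun 'I_d -> 'I_s.+1} => a j) predT) //=.
apply: eq_bigr => b _; rewrite mulr_suml; apply: eq_bigr => a /eqP <-.
rewrite /pmon (bigD1 j) //= ffunE eqxx -mulrA; congr (_ * _); rewrite mulrC.
by congr (_ * _); apply: eq_bigr => i /negPf ne_ij; rewrite ffunE ne_ij.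
Qed.

Lemma pform_hwt_attained : exists c : {ffun 'I_d -> 'I_s.+1} -> F,
  #|[set x : {ffun 'I_d -> P1pt F} | \sum_a c a * pmon a x != 0%R]| = ((#|F| - s + 1) ^ d)%N.
Proof.
have [c1 wt_c1] := @bform_hwt_attained _ s lt_sF.
exists (fun a => \prod_j c1 (a j)).
under eq_finset do rewrite -(pform_prod (fun=> c1)).
(* A product is nonzero exactly when all factors are, so the support is the [d]-th power of the
   support of the extremal form. *)
rewrite -wt_c1 -[d in RHS]card_ord -card_ffun_on cardsE; apply: eq_card => x.
rewrite inE; apply/prodf_neq0/ffun_onP=> nz_x j; last move=> _.
  by rewrite inE; apply: nz_x.
by have := nz_x j; rewrite inE.
Qed.

(** A product of codewords expands by distributivity into the [pmon a], and each [pmon a] is itself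
    a product of codewords. *)
Lemma mem_tensor_RS (w : {ffun {ffun 'I_d -> P1pt F} -> F}) :
  reflect (exists c : {ffun 'I_d -> 'I_s.+1} -> F, forall x, w x = \sum_a c a * pmon a x)
          ((w : {ffun {ffun 'I_d -> P1pt F} -> F^o}) \in tensor_code d (RS_code F s)).
Proof.
pose M a : {ffun {ffun 'I_d -> P1pt F} -> F^o} := [ffun x => pmon a x].
have ME c x : \sum_a c a * M a x = \sum_a c a * pmon a x.
  by apply: eq_bigr => a _; rewrite ffunE.
suffices -> : tensor_code d (RS_code F s) = <<codom M>>%VS.
  by apply: (iffP (mem_span_codom M w)) => -[c Dw]; exists c => x; rewrite Dw ME.
apply/eqP; rewrite eqEsubv; apply/andP; split; apply/span_subvP=> v.
  rewrite mem_enum => /imsetP[c]; rewrite inE => /forallP RSc ->{v}.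
  have /fin_all_exists[c' Dc] j : exists c' : 'I_s.+1 -> F,
      forall P, c j P = \sum_b c' b * bmon b (val P) by apply/RS_codeP/RSc.
  apply/mem_span_codom; exists (fun a : {ffun 'I_d -> 'I_s.+1} => \prod_j c' j (a j)) => x.
  by rewrite ME -pform_prod ffunE; apply: eq_bigr => j _; rewrite Dc.
case/codomP=> a ->; apply: memv_span; rewrite mem_enum; apply/imsetP.
exists [ffun j => [ffun P => bmon (a j) (val P)]]; last first.
  by apply/ffunP=> x; rewrite !ffunE; apply: eq_bigr => j _; rewrite !ffunE.
rewrite inE; apply/forallP=> j; apply/RS_codeP; exists (fun b => (b == a j)%:R) => P.
rewrite !ffunE (bigD1 (a j)) //= eqxx mul1r big1 ?addr0 // => b /negPf->.
by rewrite mul0r.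
Qed.

End ProductForms.

(** * The Segre map as a bijection onto normalized rational points *)

Section SegrePoints.
Variables (F : finFieldType) (d : nat).
Implicit Types (S T : {set 'I_d}) (u : {ffun 'I_d -> F * F}) (x : {ffun 'I_d -> P1pt F}).

Lemma segreE u S : segre u S = \prod_j (if j \in S then (u j).1 else (u j).2).
Proof.
rewrite ffunE [RHS](bigID (mem S)) /=; congr (_ * _); apply: eq_big => // j.
- by move=> ->.
- by rewrite inE.
- by rewrite inE => /negPf->.
Qed.

Lemma seg_key_subset S T : T \subset S -> (seg_key T <= seg_key S)%N.
Proof.
move=> sTS; rewrite /seg_key [leqRHS](big_setID T) /= (setIidPr sTS); exact: leq_addr.
Qed.

Lemma seg_key_proper S T : T \proper S -> (seg_key T < seg_key S)%N.
Proof.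
move=> /properP[sTS [j Sj nTj]]; rewrite /seg_key [ltnRHS](big_setID T) /= (setIidPr sTS).
by rewrite -addn1 leq_add2l (bigD1 j) ?inE ?Sj ?nTj //= ltn_addr // expn_gt0.
Qed.

Definition P1_repr x : {ffun 'I_d -> F * F} := [ffun j => val (x j)].
(** This set indexes the first nonzero Segre coordinate; outside it every factor is the point at
    infinity. *)
Definition finite_support x : {set 'I_d} := [set j | (val (x j)).1 == 1].

Lemma P1_not_finite (P : P1pt F) : ((val P).1 == 1) = false -> val P = (0, 1).
Proof.
case: P => -[u v] nP; move: nP => /=; rewrite /P1_norm /= => /orP[-> // | ].
by move=> /andP[/eqP-> /eqP->].
Qed.

Lemma segre_support x : segre (P1_repr x) (finite_support x) = 1.
Proof.
rewrite segreE big1 // => j _; rewrite inE ffunE.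
by case: ifP => [/eqP // | /P1_not_finite->].
Qed.

Lemma segre_nz_subset x T : segre (P1_repr x) T != 0 -> T \subset finite_support x.
Proof.
rewrite segreE => nz_T; apply/subsetP=> j Tj; rewrite inE; apply: contraNT nz_T.
by move/negbTE/P1_not_finite=> xj; rewrite (bigD1 j) //= Tj ffunE xj mul0r.
Qed.

(** Nonzero coordinates are indexed by subsets of the finite support, and a subset never has a
    larger key, so the coordinate 1 at the support comes first. *)
Lemma segre_norm x : H_norm (segre (P1_repr x)).
Proof.
apply/existsP; exists (finite_support x); rewrite segre_support eqxx /=.
apply/forallP=> T; apply/implyP; rewrite ltnNge; apply: contraNT => nz_T.
exact/seg_key_subset/segre_nz_subset.
Qed.

Lemma segre_on_segre x : on_segre (segre (P1_repr x)).
Proof.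
apply/existsP; exists (P1_repr x); apply/andP; split; last first.
  by apply/existsP; exists 1; apply/eqP/ffunP=> S; rewrite [RHS]ffunE mul1r.
apply/forallP=> j; rewrite ffunE; case: (x j) => -[a b] nP; move: nP => /=.
rewrite /P1_norm /=; apply: contraL => /eqP[-> ->].
by rewrite eq_sym oner_eq0 andbF.
Qed.

Lemma segre_Hpt x : H_norm (segre (P1_repr x)) && on_segre (segre (P1_repr x)).
Proof. by rewrite segre_norm segre_on_segre. Qed.

Definition segre_pt x : Hpt F d := exist _ (segre (P1_repr x)) (segre_Hpt x).

(** Removing [j] replaces only the factor [u_j = 1] by [v_j]; this recovers the affine coordinates
    in the proof of injectivity. *)
Lemma segre_supportD1 x j : j \in finite_support x ->
  segre (P1_repr x) (finite_support x :\ j) = (val (x j)).2.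
Proof.
move=> fin_j; rewrite segreE (bigD1 j) //= !inE eqxx /= ffunE big1 ?mulr1 //.
move=> i ne_ij; rewrite !inE ne_ij ffunE /=.
by case: ifP => [/eqP // | /P1_not_finite->].
Qed.

Lemma segre_pt_inj : injective segre_pt.
Proof.
move=> x y /(congr1 val) /= eq_xy.
have eq_fin : finite_support x = finite_support y.
  apply/eqP; rewrite eqEsubset; apply/andP; split.
    by apply: segre_nz_subset; rewrite -eq_xy segre_support oner_eq0.
  by apply: segre_nz_subset; rewrite eq_xy segre_support oner_eq0.
apply/ffunP=> j; apply: val_inj; have := eq_fin => /setP/(_ j).
rewrite !inE; case: eqP => [xj1 /esym/eqP yj1 | /eqP/negbTE/P1_not_finite->].
  have fin_j : j \in finite_support x by rewrite inE xj1.
  have := segre_supportD1 fin_j; rewrite eq_xy eq_fin segre_supportD1 -?eq_fin //.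
  by move: xj1 yj1; case: (val (x j)) (val (y j)) => a b [a' b'] /= -> -> ->.
by move/esym/P1_not_finite->.
Qed.

Lemma P1_normalize (z : F * F) : z != (0, 0) ->
  exists (P : P1pt F) (k : F), z = (k * (val P).1, k * (val P).2).
Proof.
case: z => a b nz_ab; case: (eqVneq a 0) => [a0 | nz_a].
  by exists (P1_inf F), b; rewrite /= mulr0 mulr1 a0.
by exists (P1_aff (b / a)), a; rewrite /= mulr1 mulrCA mulfV ?mulr1.
Qed.

Lemma segre_pt_surj (P : Hpt F d) : exists x, segre_pt x = P.
Proof.
case: P => p pP; have /andP[/existsP[S /andP[/eqP pS1 /forallP p_lt]]] := pP.
case/existsP=> u /andP[/forallP nz_u /existsP[l /eqP Dp]].
have /fin_all_exists[x] j := P1_normalize (nz_u j); case/fin_all_exists=> k Du.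
pose y : {ffun 'I_d -> P1pt F} := finfun x.
have {}Dp T : p T = (l * \prod_j k j) * segre (P1_repr y) T.
  rewrite Dp ffunE -mulrA; congr (_ * _); rewrite !segreE -big_split /=.
  by apply: eq_bigr => j _; rewrite !ffunE Du /=; case: ifP.
exists y; apply: val_inj; apply/ffunP=> T /=; rewrite Dp.
(* This scalar is the coordinate at the finite support. Were the leading index [S] different, it
   would be a proper subset of the support, hence of smaller key, and normalization would make the
   nonzero scalar vanish. *)
suffices -> : l * \prod_j k j = 1 by rewrite mul1r.
have pfin := Dp (finite_support y); rewrite segre_support mulr1 in pfin.
rewrite -pfin; have [<- // | ne_S] := eqVneq S (finite_support y).
have nz_lk : l * \prod_j k j != 0.
  by apply/eqP=> lk0; have /eqP := pS1; rewrite Dp lk0 mul0r eq_sym oner_eq0.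
have sS : S \subset finite_support y.
  apply: segre_nz_subset; apply/eqP=> S0; have /eqP := pS1.
  by rewrite Dp S0 mulr0 eq_sym oner_eq0.
have := implyP (p_lt (finite_support y)); rewrite pfin (negPf nz_lk).
by move=> /(_ (seg_key_proper _)); rewrite properEneq ne_S sS => /(_ isT).
Qed.

Lemma segre_pt_bij : bijective segre_pt.
Proof.
have /fin_all_exists[f fK] := segre_pt_surj.
by exists f => // x; apply: segre_pt_inj; rewrite fK.
Qed.

End SegrePoints.

(** * Restriction of forms of degree [s] to the Segre variety *)

Section SegreCode.
Variables (F : finFieldType) (d s : nat).

Lemma segre_monom_prod (m : {set 'I_d} -> nat) (u : {ffun 'I_d -> F * F}) :
  \prod_S segre u S ^+ m S =
  \prod_j ((u j).1 ^+ (\sum_(S : {set 'I_d} | j \in S) m S) *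
           (u j).2 ^+ (\sum_(S : {set 'I_d} | j \notin S) m S)).
Proof.
under eq_bigr do rewrite segreE -prodrXl.
rewrite exchange_big; apply: eq_bigr => j _.
rewrite (bigID (fun S : {set 'I_d} => j \in S)) /=.
rewrite -!prodrXr; congr (_ * _); apply: eq_bigr => S; first by move=> ->.
by move/negPf->.
Qed.

(* The exponents [a] come from the monomial [\prod_(t < s) x_(S_t)] with
   [S_t = {j | a j <= t}]: then [j] lies outside exactly [a j] of the [S_t]. *)
Definition segre_monom (a : {ffun 'I_d -> 'I_s.+1}) : monom {set 'I_d} s :=
  [ffun S => inord #|[set t : 'I_s | [set j | a j <= t]%N == S]|].

Lemma segre_monomE a S :
  segre_monom a S = #|[set t : 'I_s | [set j | a j <= t]%N == S]| :> nat.
Proof. by rewrite ffunE inordK // ltnS (leq_trans (max_card _)) ?card_ord. Qed.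

Lemma sum_segre_monom a (Q : pred {set 'I_d}) :
  (\sum_(S | Q S) segre_monom a S = #|[set t : 'I_s | Q [set j | a j <= t]%N]|)%N.
Proof.
rewrite -sum1dep_card (partition_big (fun t : 'I_s => [set j | a j <= t]%N) Q) //=.
apply: eq_bigr => S QS; rewrite segre_monomE -sum1dep_card; apply: eq_bigl => t.
by case: eqP => [->|]; rewrite ?QS ?andbF.
Qed.

Lemma segre_monom_deg a : mdeg (segre_monom a) = s.
Proof.
by rewrite /mdeg sum_segre_monom -[RHS]card_ord -cardsT; congr #|pred_of_set _|;
   apply/setP=> t; rewrite !inE.
Qed.

Lemma segre_monom_out a j :
  (\sum_(S : {set 'I_d} | j \notin S) segre_monom a S = a j)%N.
Proof.
rewrite sum_segre_monom -sum1dep_card -[RHS]card_ord -sum1_card.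
rewrite (big_ord_widen s (fun=> 1%N)) -1?ltnS //; apply: eq_bigl => t.
by rewrite inE -ltnNge.
Qed.

Lemma mem_H_code (w : {ffun Hpt F d -> F}) :
  w \in H_code F d s <-> exists c : {ffun 'I_d -> 'I_s.+1} -> F,
    forall x, w (segre_pt x) = \sum_a c a * pmon a x.
Proof.
have [f segreK fK] := segre_pt_bij F d.
(* This is the exponent of [v_j] after restriction; in degree [s] it is at most [s], so [inord]
   preserves it, and the exponent of [u_j] is the complement to [s]. *)
pose out (m : monom {set 'I_d} s) (j : 'I_d) := (\sum_(S : {set 'I_d} | j \notin S) m S)%N.
pose g m : {ffun 'I_d -> 'I_s.+1} := [ffun j => inord (out m j)].
have splitE (m : monom {set 'I_d} s) (j : 'I_d) :
    mdeg m = (\sum_(S : {set 'I_d} | j \in S) m S + out m j)%N.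
  by rewrite /mdeg (bigID (fun S : {set 'I_d} => j \in S)).
have Mg m (P : Hpt F d) : mdeg m = s -> \prod_v val P v ^+ m v = pmon (g m) (f P).
  move=> deg_m; rewrite -{1}[P]fK /= segre_monom_prod; apply: eq_bigr => j _.
  have := splitE m j; rewrite deg_m => Ds; rewrite !ffunE /bmon inordK; last first.
    by rewrite ltnS [leqRHS]Ds leq_addl.
  by congr (_ ^+ _ * _); rewrite [X in (X - _)%N]Ds addnK.
have Mmon a (P : Hpt F d) : \prod_v val P v ^+ segre_monom a v = pmon a (f P).
  rewrite Mg ?segre_monom_deg //; congr pmon.
  by apply/ffunP=> j; rewrite ffunE /out segre_monom_out inord_val.
have codeP := eval_codeP Mg segre_monom_deg Mmon w.
split=> [/codeP[c Dw] | [c Dw]]; last first.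
  by apply/codeP; exists c => P; rewrite -[P in LHS]fK Dw.
by exists c => x; rewrite Dw; apply: eq_bigr => a _; rewrite segreK.
Qed.

End SegreCode.

(** * Parameters and tensor structure of the Segre code *)

Theorem theorem4p1 (F : finFieldType) (d s : nat) :
  (2 <= d)%N -> (s < #|F|)%N ->
  [/\ #|{: Hpt F d}| = (#|F| + 1) ^ d,
      code_dim (H_code F d s) = (s + 1) ^ d,
      min_dist (H_code F d s) ((#|F| - s + 1) ^ d)
    & exists2 sigma : Hpt F d -> {ffun 'I_d -> P1pt F},
        bijective sigma &
        forall w : {ffun {ffun 'I_d -> P1pt F} -> F},
          ((w : {ffun {ffun 'I_d -> P1pt F} -> F^o}) \in tensor_code d (RS_code F s)) =
          ([ffun P => w (sigma P)] \in H_code F d s)]%N.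
Proof.
move=> _ lt_sF; have bij_pt := segre_pt_bij F d; have [sigma ptK sigmaK] := bij_pt.
have hwt_pt (w : {ffun Hpt F d -> F}) :
    hwt w = #|[set x | w (segre_pt x) != 0]|.
  rewrite /hwt -(on_card_preimset (onW_bij _ bij_pt)); apply: eq_card => x.
  by rewrite !inE.
have wP (w : {ffun Hpt F d -> F}) : w != 0 -> exists x, w (segre_pt x) != 0.
  move=> nz_w; apply/existsP; apply: contraNT nz_w; rewrite negb_exists => /forallP w0.
  by apply/eqP/ffunP=> P; rewrite ffunE -[P]sigmaK; apply/eqP; rewrite -[_ == _]negbK w0.
split.
- by rewrite -(bij_eq_card bij_pt) card_ffun card_P1 card_ord addn1.
- pose M (a : {ffun 'I_d -> 'I_s.+1}) P := pmon a (sigma P).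
  rewrite (code_dim_basis (M := M)).
  + by rewrite card_ffun !card_ord addn1.
  + move=> w; split=> [/mem_H_code[c Dw] | [c Dw]].
      by exists c => P; rewrite -[P in LHS]sigmaK.
    by apply/mem_H_code; exists c => x; rewrite Dw; under eq_bigr do rewrite /M ptK.
  + move=> c c0; apply: (pmon_free lt_sF) => x.
    by rewrite -[RHS](c0 (segre_pt x)); under [RHS]eq_bigr do rewrite /M ptK.
- have wt_lb w : w \in H_code F d s -> w != 0 -> ((#|F| - s + 1) ^ d <= hwt w)%N.
    move=> /mem_H_code[c Dw] /wP[x nz_wx]; rewrite hwt_pt.
    exact: (pform_hwt lt_sF Dw nz_wx).
  split=> //; have [c wt_c] := @pform_hwt_attained F d s lt_sF.
  pose w : {ffun Hpt F d -> F} := [ffun P => \sum_a c a * pmon a (sigma P)].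
  have Dw x : w (segre_pt x) = \sum_a c a * pmon a x.
    by rewrite ffunE; under eq_bigr do rewrite ptK.
  have wt_w : hwt w = ((#|F| - s + 1) ^ d)%N.
    by rewrite hwt_pt -wt_c; apply: eq_card => x; rewrite !inE Dw.
  exists w; first by apply/mem_H_code; exists c.
  (* The word is nonzero because its weight is a power of a positive number. *)
  rewrite wt_w eqxx andbT; apply: contra_eq_neq wt_w => ->.
  rewrite /hwt eq_card0 => [|P]; last by rewrite !inE ffunE eqxx.
  by rewrite eq_sym -lt0n expn_gt0 addn1.
(* Along [sigma], both codes consist of the combinations of the same functions [pmon a]. *)
exists sigma => [|w]; first by exists (@segre_pt F d).
apply/mem_tensor_RS/idP=> [[c Dw] | /mem_H_code[c Dw]].
  by apply/mem_H_code; exists c => x; rewrite ffunE ptK.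
by exists c => x; rewrite -Dw ffunE ptK.
Qed.
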